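(* Let $C_5$ be the $3$-graph on vertex set $\{1,2,3,4,5\}$ with $3$-edges $123, 234, 345, 145, 125$. For every positive integer $n$, $$2\left\lfloor\frac n4\right\rfloor\le \mathrm{co^+ex}(n,C_5)\le \frac23 n .$$
   Context: A $3$-graph is a finite $3$-uniform hypergraph; an edge is written as the concatenation of its vertices. The minimum positive co-degree $\delta_2^+(H)$ of a non-empty $3$-graph $H$ is the maximum $k$ such that every pair of vertices contained in some edge of $H$ is contained in at least $k$ distinct edges of $H$; by convention it is $0$ if $H$ has no edges. A hypergraph is $F$-free if it has no (not necessarily induced) subhypergraph isomorphic to $F$. $\mathrm{co^+ex}(n,F)$ is the maximum of $\delta_2^+(H)$ over all $n$-vertex $F$-free $3$-graphs $H$. *)

(* Defs.v *)
From HB Require Import structures.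
From mathcomp Require Import all_boot all_order all_algebra.

Set Implicit Arguments.
Unset Strict Implicit.
Unset Printing Implicit Defensive.

(* Hypergraphs on the vertex type [T] are represented by their edge sets. *)

Definition is_3graph (T : finType) (E : {set {set T}}) : bool :=
  [forall e in E, #|e| == 3].

Definition codegree (T : finType) (E : {set {set T}}) (p : {set T}) : nat :=
  #|[set e in E | p \subset e]|.

Definition positive_pair (T : finType) (E : {set {set T}}) (p : {set T}) : bool :=
  (#|p| == 2) && [exists e in E, p \subset e].

(* The range bound on [k] is no restriction: a non-empty 3-graph has a positive
   pair, and every codegree is at most [#|E|]. *)
Definition min_pos_codegree (T : finType) (E : {set {set T}}) : nat :=
  if E == set0 then 0
  else \max_(k < #|E|.+1 | [forall p, positive_pair E p ==> (k <= codegree E p)]) k.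

(* Some not necessarily induced subhypergraph of [E] is isomorphic to [F]. *)
Definition has_copy (S T : finType) (F : {set {set S}}) (E : {set {set T}}) : bool :=
  [exists f : {ffun S -> T}, injectiveb f && [forall e in F, f @: e \in E]].

Definition free (S T : finType) (F : {set {set S}}) (E : {set {set T}}) : bool :=
  ~~ has_copy F E.

Definition copex (n : nat) (S : finType) (F : {set {set S}}) : nat :=
  \max_(E : {set {set 'I_n}} | is_3graph E && free F E) min_pos_codegree E.

(* The element [i] of ['I_5] stands for the vertex [i + 1] of {1, ..., 5}. *)
Definition edge5 (a b c : nat) : {set 'I_5} :=
  [set i : 'I_5 | i.+1 \in [:: a; b; c]].

Definition C5 : {set {set 'I_5}} :=
  [set edge5 1 2 3; edge5 2 3 4; edge5 3 4 5; edge5 1 4 5; edge5 1 2 5].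

(* Main.v *)
Require Import Defs.
From mathcomp Require Import all_boot all_order all_algebra.
From mathcomp Require Import zify lra.

Set Implicit Arguments.
Unset Strict Implicit.
Unset Printing Implicit Defensive.

(* Upper bound: if three times the minimum positive codegree exceeds 2n, then by
   pigeonhole the three neighbourhoods of the pairs of an edge abc share a vertex
   d, so abcd spans a K_4.  The six neighbourhoods of the pairs of abcd have
   total size above 4n, so some vertex v lies in at least five of them.  The link
   of v on abcd then contains a Hamiltonian path, and v together with this path
   closes a C_5.
   Lower bound: take the complete 4-partite 3-graph with balanced parts.  Any two
   vertices of C_5 lie in a common edge, so a copy of C_5 would need five parts. *)

Lemma card_set3_neq {T : finType} (x y z : T) :
  #|[set x; y; z]| = 3 -> [/\ x != y, x != z & y != z].
Proof.
rewrite setUC cardsU1 cards2 !inE.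
by rewrite (eq_sym z x) (eq_sym z y); case: (x == y); case: (x == z); case: (y == z).
Qed.

Lemma set3_rot {T : finType} (x y z : T) : [set x; y; z] = [set y; z; x].
Proof. by rewrite -setUA setUC. Qed.

Lemma set3_swap {T : finType} (x y z : T) : [set x; y; z] = [set y; x; z].
Proof. by rewrite (setUC [set x]). Qed.

Ltac perm3 := first [ done | by rewrite set3_rot | by rewrite -set3_rot
  | by rewrite set3_swap | by rewrite set3_swap set3_rot
  | by rewrite set3_swap -set3_rot ].

(** Double counting of the incidences between vertices and sets. A list is used, so that sets which
    happen to coincide still count separately. *)
Lemma pigeonhole_count {T : finType} (r : nat) (s : seq {set T}) :
  r * #|T| < \sum_(A <- s) #|A| ->
  exists v, r < count (fun A : {set T} => v \in A) s.
Proof.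
move=> lt_r; apply/existsP; apply: contraLR lt_r; rewrite negb_exists -leqNgt.
move=> /forallP le_r.
have -> : \sum_(A <- s) #|A| = \sum_v count (fun A : {set T} => v \in A) s.
  under [RHS]eq_bigr do rewrite -sum1_count big_mkcond.
  by rewrite exchange_big; apply: eq_bigr => A _; rewrite -sum1_card [LHS]big_mkcond.
rewrite mulnC -sum_nat_const; apply: leq_sum => v _.
by rewrite leqNgt le_r.
Qed.

(** The successors absorb the shift between the labels 1 to 5 and the ordinals 0 to 4. *)
Lemma edge5E (a b c : nat) : a < 5 -> b < 5 -> c < 5 ->
  edge5 a.+1 b.+1 c.+1 = [set inord a; inord b; inord c].
Proof.
by move=> *; apply/setP => i; rewrite !inE -!val_eqE /= !inordK // !eqSS orbA.
Qed.

(** Distinctness of the five vertices comes for free: each of the ten pairs lies in one of the five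
    edges, and every edge has exactly three elements. *)
Lemma C5_copy {T : finType} (E : {set {set T}}) (x1 x2 x3 x4 x5 : T) :
  is_3graph E ->
  [set x1; x2; x3] \in E -> [set x2; x3; x4] \in E -> [set x3; x4; x5] \in E ->
  [set x1; x4; x5] \in E -> [set x1; x2; x5] \in E -> has_copy C5 E.
Proof.
move=> /forall_inP E3 e1 e2 e3 e4 e5.
have neq x y z : [set x; y; z] \in E -> [/\ x != y, x != z & y != z].
  by move=> /E3 /eqP; apply: card_set3_neq.
have [n12 n13 n23] := neq _ _ _ e1; have [_ n24 n34] := neq _ _ _ e2.
have [_ n35 n45] := neq _ _ _ e3; have [n14 n15 _] := neq _ _ _ e4.
have [_ _ n25] := neq _ _ _ e5.
pose s := [:: x1; x2; x3; x4; x5].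
have us : uniq s.
  by rewrite /= !inE !negb_or n12 n13 n14 n15 n23 n24 n25 n34 n35 n45.
apply/existsP; exists [ffun i : 'I_5 => nth x1 s i]; apply/andP; split.
  apply/injectiveP => i j; rewrite !ffunE => /eqP.
  by rewrite nth_uniq // => /eqP /val_inj.
apply/forall_inP => e; rewrite !inE => e_C5.
by case/orP: e_C5 => [/orP[/orP[/orP[]|]|]|] /eqP ->;
  rewrite edge5E // !imsetU !imset_set1 !ffunE !inordK.
Qed.

Section UpperBound.
Context {T : finType} (E : {set {set T}}) (E3 : is_3graph E).

Definition nbhd (x y : T) : {set T} := [set v | [set x; y; v] \in E].

(** Every edge through the pair is determined by its third vertex, so these edges lie in the image
    of [nbhd x y] under [v] to [[set x; y; v]]. *)
Lemma codegree_nbhd (x y : T) : x != y -> codegree E [set x; y] <= #|nbhd x y|.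
Proof.
move=> xy; apply: leq_trans (leq_imset_card (fun v => [set x; y; v]) (nbhd x y)).
apply/subset_leq_card/subsetP => e; rewrite inE => /andP[eE xye].
have /cards1P[v ev] : #|e :\: [set x; y]| == 1.
  by rewrite cardsDS // cards2 xy (eqP (forall_inP E3 e eE)).
have e_eq : e = [set x; y; v] by rewrite -(setID e [set x; y]) (setIidPr xye) ev.
by rewrite {1}e_eq; apply: imset_f; rewrite inE -e_eq.
Qed.

Lemma free_C5_codegree (k : nat) : Defs.free C5 E -> E != set0 ->
  (forall p, positive_pair E p -> k <= codegree E p) -> 3 * k <= 2 * #|T|.
Proof.
move=> freeE /set0Pn[e eE] le_k; rewrite leqNgt; apply/negP => lt_k.
have neq x y z : [set x; y; z] \in E -> [/\ x != y, x != z & y != z].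
  by move=> h; apply/card_set3_neq/eqP/(forall_inP E3).
have le_nbhd x y z : [set x; y; z] \in E -> k <= #|nbhd x y|.
  move=> h; have [xy _ _] := neq _ _ _ h.
  apply: leq_trans (codegree_nbhd xy); apply: le_k.
  rewrite /positive_pair cards2 xy; apply/exists_inP.
  by exists [set x; y; z] => //; apply: subsetUl.
have [a [b [c e_abc]]] : exists a b c, e = [set a; b; c].
  have /eqP e3 := forall_inP E3 e eE.
  have /set0Pn[c ce] : e != set0 by rewrite -card_gt0 e3.
  have /cards2P[a [b [_ ab]]] : #|e :\ c| == 2.
    by rewrite -eqSS -e3 (cardsD1 c e) ce.
  by exists a, b, c; rewrite -ab setUC setD1K.
rewrite {}e_abc in eE.
(* The sizes add up to at least [3 * k], so some [d] lies in more than two of the three sets, that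
   is, in all of them. *)
have [|d] := @pigeonhole_count T 2 [:: nbhd a b; nbhd b c; nbhd c a].
  have h1 := le_nbhd a b c eE.
  have h2 : k <= #|nbhd b c| by apply: (le_nbhd _ _ a); perm3.
  have h3 : k <= #|nbhd c a| by apply: (le_nbhd _ _ b); perm3.
  by rewrite !big_cons big_nil; lia.
rewrite /= !inE => d3.
have [abd bcd cad] : [/\ [set a; b; d] \in E, [set b; c; d] \in E & [set c; a; d] \in E].
  by move: d3; do 3!case: (_ \in E).
have [|v] := @pigeonhole_count T 4
    [:: nbhd a b; nbhd b c; nbhd c d; nbhd b d; nbhd d a; nbhd a c].
  have h1 := le_nbhd a b c eE.
  have h2 := le_nbhd b c d bcd.
  have h3 : k <= #|nbhd c d| by apply: (le_nbhd _ _ b); perm3.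
  have h4 : k <= #|nbhd b d| by apply: (le_nbhd _ _ a); perm3.
  have h5 : k <= #|nbhd d a| by apply: (le_nbhd _ _ b); perm3.
  have h6 : k <= #|nbhd a c| by apply: (le_nbhd _ _ d); perm3.
  by rewrite !big_cons big_nil; lia.
rewrite /= !inE => v5.
(* The paths a-b-c-d and b-d-a-c partition the six pairs, and [v] misses at most
   one pair. *)
have : [&& [set a; b; v] \in E, [set b; c; v] \in E & [set c; d; v] \in E] ||
       [&& [set b; d; v] \in E, [set d; a; v] \in E & [set a; c; v] \in E].
  by move: v5; do 6!case: (_ \in E).
move: freeE => /negP + H; apply.
(* For a path p-q-r-s in the link of [v], the cyclic order r, s, p, q, [v] gives a [C5]: the edges
   rsp and spq come from the K_4, while pq, qr and rs are completed by [v]. *)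
case/orP: H => /and3P[h1 h2 h3].
  by apply: (@C5_copy _ E c d a b v) => //; perm3.
by apply: (@C5_copy _ E a c b d v) => //; perm3.
Qed.

End UpperBound.

Lemma copex_C5_le (n : nat) : 3 * copex n C5 <= 2 * n.
Proof.
(* Dividing by 3 isolates the maximum, so that it can be bounded term by term; the same is done
   below for the inner maximum. *)
rewrite /copex mulnC -leq_divRL //; apply/bigmax_leqP => E /andP[E3 freeE].
rewrite leq_divRL // mulnC /min_pos_codegree; case: eqP => // /eqP E0.
rewrite mulnC -leq_divRL //; apply/bigmax_leqP => k /forallP le_k.
rewrite leq_divRL // mulnC -[n in 2 * n]card_ord.
by apply: (free_C5_codegree E3 freeE E0) => p; apply/implyP.
Qed.

Lemma min_pos_codegree_ge {T : finType} (E : {set {set T}}) (k : nat) :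
  is_3graph E -> E != set0 ->
  (forall p, positive_pair E p -> k <= codegree E p) -> k <= min_pos_codegree E.
Proof.
move=> E3 E0 le_k; rewrite /min_pos_codegree (negbTE E0).
(* The maximum ranges only over values up to [#|E|]; a pair inside some edge has codegree at most
   [#|E|], which puts [k] in range. *)
have k_lt : k < #|E|.+1.
  have /set0Pn[e eE] := E0; have /eqP e3 := forall_inP E3 e eE.
  have /set0Pn[c ce] : e != set0 by rewrite -card_gt0 e3.
  have ec : positive_pair E (e :\ c).
    rewrite /positive_pair -eqSS -e3 (cardsD1 c e) ce eqxx /=.
    by apply/exists_inP; exists e => //; apply: subsetDl.
  apply: leq_trans (le_k _ ec) _; apply/subset_leq_card/subsetP => x.
  by rewrite inE => /andP[].
by apply: (bigmax_sup (Ordinal k_lt)) => //; apply/forallP => p; apply/implyP/le_k.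
Qed.

Section Multipartite.
Context {T C : finType} (c : T -> C).

(** The complete multipartite 3-graph whose parts are the fibres of [c]: the image condition makes
    the three colours distinct. *)
Definition multipartite : {set {set T}} :=
  [set e : {set T} | (#|e| == 3) && (#|c @: e| == 3)].

Lemma multipartite_3graph : is_3graph multipartite.
Proof. by apply/forall_inP => e; rewrite inE => /andP[]. Qed.

Lemma multipartite_inj (e : {set T}) : e \in multipartite -> {in e &, injective c}.
Proof. by rewrite inE => /andP[/eqP e3 /eqP ce3]; apply/imset_injP; rewrite e3 ce3. Qed.

Lemma mem_multipartite (x y z : T) : c x != c y -> c x != c z -> c y != c z ->
  [set x; y; z] \in multipartite.
Proof.
have card3 (S : finType) (u v w : S) : u != v -> u != w -> v != w ->
    #|[set u; v; w]| = 3.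
  move=> uv uw vw; rewrite setUC cardsU1 cards2 !inE.
  by rewrite (eq_sym w u) (eq_sym w v) (negbTE uw) (negbTE vw) uv.
move=> xy xz yz; rewrite inE !imsetU !imset_set1 !card3 //.
- by apply: contra_neq xy => ->.
- by apply: contra_neq xz => ->.
- by apply: contra_neq yz => ->.
Qed.

(** Used to pass from injectivity of a colouring on each edge to injectivity on all five
    vertices. *)
Lemma C5_covers_pairs (i j : 'I_5) : exists2 e, e \in C5 & (i \in e) && (j \in e).
Proof.
suff : [|| (i \in edge5 1 2 3) && (j \in edge5 1 2 3),
          (i \in edge5 2 3 4) && (j \in edge5 2 3 4),
          (i \in edge5 3 4 5) && (j \in edge5 3 4 5),
          (i \in edge5 1 4 5) && (j \in edge5 1 4 5) |
          (i \in edge5 1 2 5) && (j \in edge5 1 2 5)].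
  by case/or4P=> [||| /orP[]] ij; eexists; try exact: ij; rewrite !inE eqxx ?orbT.
by rewrite !inE; case: i j => [[|[|[|[|[|i]]]]] ?] [[|[|[|[|[|j]]]]] ?].
Qed.

Lemma multipartite_free : #|C| < 5 -> Defs.free C5 multipartite.
Proof.
apply: contraL => /existsP[f /andP[/injectiveP f_inj /forall_inP f_C5]].
rewrite -leqNgt -[5]card_ord; apply: (@leq_card _ _ (c \o f)) => i j /= cfij.
have [e e_C5 /andP[ie je]] := C5_covers_pairs i j.
by apply/f_inj/(multipartite_inj (f_C5 _ e_C5)); rewrite ?imset_f.
Qed.

(** A positive pair uses two colours; any vertex of one of the other [#|C| - 2] colours completes it
    to an edge, and different vertices give different edges. *)
Lemma multipartite_codegree (m : nat) (p : {set T}) :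
  (forall a, m <= #|c @^-1: [set a]|) -> positive_pair multipartite p ->
  (#|C| - 2) * m <= codegree multipartite p.
Proof.
move=> le_m /andP[/cards2P[x [y [xy ->]]] /exists_inP[e eE pe]] {p}.
have cxy : c x != c y.
  apply: contra_neq xy => /(multipartite_inj eE); apply; apply: (subsetP pe).
    exact: set21.
  exact: set22.
pose A := c @^-1: ~: [set c x; c y].
have A_E v : v \in A -> [set x; y; v] \in multipartite.
  rewrite inE in_setC in_set2 negb_or !(eq_sym (c v)) => /andP[xv yv].
  exact: mem_multipartite.
have third_inj : {in A &, injective (fun v => [set x; y; v])}.
  move=> u v uA vA eq_uv.
  have : u \in [set x; y; v] by rewrite -eq_uv set1Ur.
  rewrite !inE => /orP[/orP[]|] /eqP // ux;
    by move: uA; rewrite ux !inE eqxx ?orbT.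
apply: (@leq_trans #|A|); last first.
  rewrite -(card_in_imset third_inj); apply/subset_leq_card/subsetP => _ /imsetP[v vA ->].
  by rewrite inE A_E //= subsetUl.
have -> : #|A| = \sum_(a in ~: [set c x; c y]) #|c @^-1: [set a]|.
  rewrite -sum1_card (partition_big c (mem (~: [set c x; c y]))) /=; last first.
    by move=> v; rewrite inE.
  apply: eq_bigr => a aA; rewrite -sum1_card; apply: eq_bigl => v.
  rewrite !inE in aA *; case: (c v =P a) => [->|_]; last exact: andbF.
  by rewrite andbT.
have -> : #|C| - 2 = #|~: [set c x; c y]|.
  by rewrite -(cardsC [set c x; c y]) cards2 cxy addKn.
by rewrite -sum_nat_const; apply: leq_sum.
Qed.

End Multipartite.

(** The numbers [4 * j + a] with [j < n %/ 4] are distinct, below [n], and in the class. *)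
Lemma card_residue_class (n : nat) (a : 'I_4) :
  n %/ 4 <= #|[set i : 'I_n | inord (i %% 4) == a]|.
Proof.
have lt_n (j : 'I_(n %/ 4)) : 4 * j + a < n.
  by have := ltn_ord j; have := ltn_ord a; lia.
rewrite -[n %/ 4]card_ord -(@card_imset _ _ (fun j => Ordinal (lt_n j))).
  apply/subset_leq_card/subsetP => _ /imsetP[j _ ->].
  by rewrite inE /= mulnC modnMDl modn_small // inord_val.
by move=> i j /(congr1 val) /= ij; apply: val_inj => /=; lia.
Qed.

Lemma copex_C5_ge (n : nat) : 2 * (n %/ 4) <= copex n C5.
Proof.
(* For [n < 4] the bound is 0. Otherwise all four colours occur, which makes the 4-partite 3-graph
   non-empty, as a positive codegree requires. *)
have [n_lt4|n_ge4] := ltnP n 4; first by rewrite divn_small.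
pose c (i : 'I_n) : 'I_4 := inord (i %% 4).
pose E := multipartite c.
have E3 : is_3graph E := multipartite_3graph c.
apply: (@leq_trans (min_pos_codegree E)); last first.
  apply: (@leq_bigmax_cond _ _ (@min_pos_codegree _) E).
  by rewrite E3 multipartite_free // card_ord.
apply: min_pos_codegree_ge => // [|p pE].
  pose v (a : 'I_4) : 'I_n := Ordinal (leq_trans (ltn_ord a) n_ge4).
  have cv a : c (v a) = a by rewrite /c /= modn_small // inord_val.
  apply/set0Pn; exists [set v 0%R; v 1%R; v 2%R].
  by apply: mem_multipartite; rewrite !cv.
have := @multipartite_codegree _ _ c (n %/ 4) p _ pE; rewrite card_ord; apply=> a.
have := card_residue_class n a; congr (_ <= _); apply: eq_card => i.
by rewrite !inE.
Qed.

Theorem theorem14 (n : nat) (n_gt0 : (0 < n)%N) :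
  (2 * (n %/ 4) <= copex n C5)%N /\
  ((copex n C5)%:R <= 2 / 3 * n%:R :> rat)%R.
Proof.
split; first exact: copex_C5_ge.
have : (3 * (copex n C5)%:R <= 2 * n%:R :> rat)%R.
  by rewrite -!GRing.natrM Num.Theory.ler_nat copex_C5_le.
lra.
Qed.
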